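(* Let $0<\xi<1$ and $\alpha>0$. There is a constant $C>0$, independent of $n$ and of $f$, such that for every $f\in C_{\bar w}$ and every positive integer $n$ for which $\bar B_n$ is defined, $$\|\bar w\,\bar B_n''(f)\|\le C n^2\|\bar w f\|,$$ where $\bar B_n''(f)$ is the second derivative in $x$ of the polynomial $\bar B_n(f,x)$.
   Context: Let $\bar w(x)=|x-\xi|^\alpha$ on $[0,1]$, and let $C_{\bar w}$ be the set of $f\in C([0,1]\setminus\{\xi\})$ with $\lim_{x\to\xi}\bar w(x)f(x)=0$; the product $\bar w f$ is understood to be $0$ at $\xi$. $\|\cdot\|$ is the supremum norm on $[0,1]$. Bernstein operators: $B_n(g,x)=\sum_{k=0}^n g(k/n)p_{n,k}(x)$, $p_{n,k}(x)=\binom nk x^k(1-x)^{n-k}$. Let $\psi(x)=10x^3-15x^4+6x^5$ for $0<x<1$, $\psi(x)=0$ for $x\le 0$, $\psi(x)=1$ for $x\ge 1$. With $[\cdot]$ the integer part, set $$x_1=\tfrac{[n\xi-2\sqrt n]}{n},\quad x_2=\tfrac{[n\xi-\sqrt n]}{n},\quad x_3=\tfrac{[n\xi+\sqrt n]}{n},\quad x_4=\tfrac{[n\xi+2\sqrt n]}{n},$$ $$\bar\psi_1(x)=\psi\Big(\frac{x-x_1}{x_2-x_1}\Big),\qquad \bar\psi_2(x)=\psi\Big(\frac{x-x_3}{x_4-x_3}\Big).$$ Here $n$ is such that $0\le x_1$ and $x_4\le 1$. For $f\in C_{\bar w}$ let $$P(x)=P(f,x)=\frac{x-x_4}{x_1-x_4}f(x_1)+\frac{x_1-x}{x_1-x_4}f(x_4)$$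 be the linear function interpolating $f$ at $x_1,x_4$, and let $$\bar F_n(f,x)=f(x)\big(1-\bar\psi_1(x)+\bar\psi_2(x)\big)+\bar\psi_1(x)\big(1-\bar\psi_2(x)\big)P(x),$$ so that $\bar F_n(f,x)=P(x)$ on $[x_2,x_3]$ (which contains $\xi$) and $\bar F_n(f,x)=f(x)$ on $[0,x_1]\cup[x_4,1]$. The modified Bernstein operator is $\bar B_n(f,x)=B_n(\bar F_n(f,\cdot),x)$. *)

(* Defs.v *)
(* MathComp-Analysis, over an arbitrary [R : realType]. *)
From mathcomp Require Import all_boot all_order all_algebra.
From mathcomp Require Import all_classical all_reals all_analysis.

Set Implicit Arguments.
Unset Strict Implicit.
Unset Printing Implicit Defensive.

Import Order.TTheory GRing.Theory Num.Theory.
Import numFieldNormedType.Exports.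

Local Open Scope classical_set_scope.
Local Open Scope ring_scope.

Section Defs.
Context {R : realType}.
Implicit Types (xi alpha x : R) (f g : R -> R) (n k : nat).

Definition wbar xi alpha x : R := `|x - xi| `^ alpha.

(* Functions on [0, 1] minus xi are represented by total functions R -> R; the
   value at xi is never constrained.  It is also harmless in [wbar xi alpha x *
   f x], because [0 `^ alpha = 0] for [alpha != 0]. *)
Definition C_wbar xi alpha : set (R -> R) :=
  [set f | {within `[0, 1]%classic `\ xi, continuous f} /\
           wbar xi alpha x * f x @[x --> xi^'] --> (0 : R)].

(* Extended-real valued, so that an unbounded function has norm +oo instead of
   the default value 0 of [sup]. *)
Definition supnorm g : \bar R := ereal_sup [set `|g x|%:E | x in `[0, 1]].

Definition bernstein_basis n k x : R :=
  'C(n, k)%:R * x ^+ k * (1 - x) ^+ (n - k).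

Definition bernstein n g x : R :=
  \sum_(k < n.+1) g (k%:R / n%:R) * bernstein_basis n k x.

Definition psi x : R :=
  if x <= 0 then 0 else if 1 <= x then 1
  else 10 * x ^+ 3 - 15 * x ^+ 4 + 6 * x ^+ 5.

Definition node n xi (c : R) : R :=
  (Num.floor (n%:R * xi + c * Num.sqrt n%:R))%:~R / n%:R.

Definition x1 n xi : R := node n xi (- 2).
Definition x2 n xi : R := node n xi (- 1).
Definition x3 n xi : R := node n xi 1.
Definition x4 n xi : R := node n xi 2.

Definition psi1 n xi x : R := psi ((x - x1 n xi) / (x2 n xi - x1 n xi)).
Definition psi2 n xi x : R := psi ((x - x3 n xi) / (x4 n xi - x3 n xi)).

Definition interp n xi f x : R :=
  (x - x4 n xi) / (x1 n xi - x4 n xi) * f (x1 n xi) +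
  (x1 n xi - x) / (x1 n xi - x4 n xi) * f (x4 n xi).

(* At [x = xi] the coefficient of [f x] is 0, since x2 <= xi <= x3. *)
Definition Fbar n xi f x : R :=
  f x * (1 - psi1 n xi x + psi2 n xi x) +
  psi1 n xi x * (1 - psi2 n xi x) * interp n xi f x.

Definition Bbar n xi f : R -> R := bernstein n (Fbar n xi f).

Definition Bbar_defined n xi : Prop := 0 <= x1 n xi /\ x4 n xi <= 1.

End Defs.

(* Main.v *)
(* Write M for the norm of wbar * f and r for 1 / sqrt n.  The nodes x1, ..., x4
   lie within 3 r of xi, x1 and x4 are at distance at least r from xi, and F_n
   uses values of f only at points at distance at least r / 2 from xi.  Hence
   |F_n(y)| <= c M (r + |y - xi|)^(- alpha) on [0, 1].
   With m = n - 2, B_n'' is n (n - 1) times the sum of the second differences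
   of F_n weighted by the Bernstein basis of degree m.  For
   t = r |k - m x| and y one of the three nodes involved,
   |x - xi| <= (2 + t) (r + |y - xi|), and (2 + t)^alpha = O(e^t).  So it remains
   to bound the mean of e^t under the binomial law, which follows from its
   moment generating function at r and - r. *)

Require Import Defs.
From mathcomp Require Import all_boot all_order all_algebra.
From mathcomp Require Import all_classical all_reals all_analysis.
From mathcomp Require Import ring lra.

Import Order.TTheory GRing.Theory Num.Theory.
Import numFieldNormedType.Exports.

Local Open Scope classical_set_scope.
Local Open Scope ring_scope.

(** * Differentiation of Bernstein polynomials *)

(** The formal counterpart of [bernstein_basis], so that derivatives become algebra. It is 0 for
    [k > n], which absorbs the boundary terms below. *)
Definition bernstein_poly {R : comNzRingType} (n k : nat) : {poly R} :=
  'C(n, k)%:R *: ('X^k * (1 - 'X) ^+ (n - k)).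

Lemma deriv_bernstein_poly0 (R : comNzRingType) (n : nat) :
  (bernstein_poly n.+1 0)^`() = - (n.+1%:R *: bernstein_poly n 0) :> {poly R}.
Proof.
rewrite /bernstein_poly !bin0 !subn0 expr0 !mul1r !scale1r deriv_exp.
by rewrite derivB derivX derivC sub0r mulN1r mulNrn scaler_nat.
Qed.

(** Each term of the product rule is rescaled by a binomial identity: (k+1) C(n+1,k+1) = (n+1)
    C(n,k) and (n-k) C(n+1,k+1) = (n+1) C(n,k+1). *)
Lemma deriv_bernstein_polyS (R : comNzRingType) (n k : nat) :
  (bernstein_poly n.+1 k.+1)^`() =
  n.+1%:R *: (bernstein_poly n k - bernstein_poly n k.+1) :> {poly R}.
Proof.
rewrite /bernstein_poly derivZ derivM derivXn /= subSS deriv_exp derivB derivX.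
rewrite derivC sub0r mulN1r mulNrn mulrN scalerBr scalerBr -!scaler_nat.
rewrite -scalerAl -scalerAr !scalerA -!natrM.
rewrite [in LHS](mulnC 'C(_, _) k.+1) -mul_bin_diag /=.
rewrite [in LHS](mulnC 'C(_, _) (n - k)%N).
by rewrite (_ : (n - k)%N = (n.+1 - k.+1)%N) // -mul_bin_down /= -subnS.
Qed.

(** Summation by parts; applied twice, it produces the second differences. *)
Lemma deriv_bernstein_sum (R : comNzRingType) (n : nat) (c : nat -> R) :
  (\sum_(k < n.+2) c k *: bernstein_poly n.+1 k)^`() =
  n.+1%:R *: \sum_(k < n.+1) (c k.+1 - c k) *: bernstein_poly n k.
Proof.
rewrite raddf_sum big_ord_recl /= derivZ deriv_bernstein_poly0.
under eq_bigr do rewrite derivZ deriv_bernstein_polyS scalerA mulrC -scalerA.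
rewrite -scaler_sumr scalerN scalerA mulrC -scalerA -scalerN -scalerDr.
congr (_ *: _).
under [X in _ + X = _]eq_bigr do rewrite scalerBr.
rewrite sumrB.
under [RHS]eq_bigr do rewrite scalerBl.
rewrite sumrB addrCA; congr (_ + _).
rewrite -opprD; congr (- _).
have bz : @bernstein_poly R n n.+1 = 0.
  by rewrite /bernstein_poly bin_small// scale0r.
transitivity (\sum_(i < n.+2) c i *: @bernstein_poly R n i).
  by rewrite [RHS]big_ord_recl.
by rewrite [LHS]big_ord_recr /= bz scaler0 addr0.
Qed.

Lemma derive1n2_bernstein (R : realType) (n : nat) (g : R -> R) (x : R) :
  derive1n 2 (bernstein n.+2 g) x = n.+2%:R * n.+1%:R *
    \sum_(k < n.+1) (g (k.+2%:R / n.+2%:R) - 2 * g (k.+1%:R / n.+2%:R)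
                      + g (k%:R / n.+2%:R)) * bernstein_basis n k x.
Proof.
pose c k := g (k%:R / n.+2%:R).
have -> : bernstein n.+2 g =
    horner (\sum_(k < n.+3) c k *: bernstein_poly n.+2 k).
  apply/funext => y; rewrite /bernstein horner_sum; apply: eq_bigr => k _.
  by rewrite /bernstein_basis /bernstein_poly !hornerE /c /=; ring.
rewrite derive1nS derive1n1 -!derivE deriv_bernstein_sum derivZ.
rewrite (deriv_bernstein_sum R n (fun k => c k.+1 - c k)).
rewrite !hornerE horner_sum /=; congr (_ * _); apply: eq_bigr => k _.
rewrite /bernstein_basis /bernstein_poly !hornerE /c /=; ring.
Qed.

(** * Exponential moments of the binomial law *)

Lemma bernstein_basis_ge0 (R : realType) (n k : nat) (x : R) :
  0 <= x <= 1 -> 0 <= bernstein_basis n k x.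
Proof.
move=> /andP[x0 x1].
by rewrite /bernstein_basis !mulr_ge0// exprn_ge0// subr_ge0.
Qed.

(** Since e^(-l) >= 1 - l, one has e^l <= 1 / (1 - l), and (1 - l)(1 + l + 2 l^2) = 1 + l^2 (1 - 2
    l) >= 1. *)
Lemma expR_le_quadratic (R : realType) (l : R) :
  `|l| <= 2^-1 -> expR l <= 1 + l + 2 * l ^+ 2.
Proof.
rewrite ler_norml => /andP[l0 l1].
have h := expR_ge1Dx (- l).
have e0 := expR_gt0 (- l).
have : expR l * expR (- l) = 1 by rewrite -expRD subrr expR0.
nra.
Qed.

(** By the binomial theorem the sum is ((1 - x) + x e^l)^n e^(-l n x). The base is at most e^(x l +
    2 l^2), whose linear part cancels the centring. *)
Lemma bernstein_expR_le (R : realType) (n : nat) (x l : R) :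
  0 <= x <= 1 -> `|l| <= 2^-1 ->
  \sum_(k < n.+1) expR (l * (k%:R - n%:R * x)) * bernstein_basis n k x
    <= expR (2 * (n%:R * l ^+ 2)).
Proof.
move=> /andP[x0 x1] ll.
have -> : \sum_(k < n.+1) expR (l * (k%:R - n%:R * x)) * bernstein_basis n k x
    = ((1 - x) + x * expR l) ^+ n * expR (- (l * (n%:R * x))).
  rewrite exprDn mulr_suml; apply: eq_bigr => k _.
  rewrite mulrBr expRD (mulrC l k%:R) expRM_natl exprMn /bernstein_basis -mulr_natl.
  ring.
have q := expR_le_quadratic _ _ ll.
have h : (1 - x) + x * expR l <= expR (x * l + 2 * l ^+ 2).
  have := expR_ge1Dx (x * l + 2 * l ^+ 2).
  have := sqr_ge0 l.
  nra.
have h0 : 0 <= (1 - x) + x * expR l.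
  by rewrite addr_ge0 ?subr_ge0// mulr_ge0// expR_ge0.
apply: (@le_trans _ _ (expR (x * l + 2 * l ^+ 2) ^+ n * expR (- (l * (n%:R * x))))).
  by rewrite ler_pM2r ?expR_gt0// lerXn2r// nnegrE expR_ge0.
rewrite -expRM_natl -expRD ler_expR.
by rewrite le_eqVlt; apply/orP; left; apply/eqP; ring.
Qed.

(** * The cutoff, the nodes and the size of [Fbar] *)

(** On (0, 1) both [psi] and its complement to 1 are a cube times a positive quadratic. *)
Lemma psi_itv (R : realType) (x : R) : 0 <= psi x <= 1.
Proof.
rewrite /psi; case: ifPn => [_|]; first by rewrite lexx ler01.
rewrite -ltNge => x0; case: ifPn => [_|]; first by rewrite lexx ler01.
rewrite -ltNge => x1.
have -> : 10 * x ^+ 3 - 15 * x ^+ 4 + 6 * x ^+ 5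
    = x ^+ 3 * (10 - 15 * x + 6 * x ^+ 2) by ring.
apply/andP; split.
  by rewrite mulr_ge0 ?exprn_ge0 ?ltW//; nra.
rewrite -subr_ge0.
have -> : 1 - x ^+ 3 * (10 - 15 * x + 6 * x ^+ 2)
    = (1 - x) ^+ 3 * (1 + 3 * x + 6 * x ^+ 2) by ring.
by rewrite mulr_ge0 ?exprn_ge0 ?subr_ge0 ?ltW//; nra.
Qed.

Lemma node_itv (R : realType) (n : nat) (xi c : R) : (0 < n)%N ->
  xi + c / Num.sqrt n%:R - n%:R^-1 < node n xi c <= xi + c / Num.sqrt n%:R.
Proof.
move=> n0; have N0 : 0 < n%:R :> R by rewrite ltr0n.
have s0 : 0 < Num.sqrt n%:R :> R by rewrite sqrtr_gt0.
have E : xi + c / Num.sqrt n%:R = (n%:R * xi + c * Num.sqrt n%:R) / n%:R.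
  have ss : Num.sqrt n%:R * Num.sqrt n%:R = n%:R :> R.
    by rewrite -expr2 sqr_sqrtr ?ltW.
  by move: s0 ss; set s := Num.sqrt _ => s0 <-; field; rewrite gt_eqF.
rewrite E -[X in _ - X]mul1r -mulrBl /node ltr_pM2r ?invr_gt0// ler_pM2r ?invr_gt0//.
rewrite floor_le andbT ltrBlDr.
by have := floorD1_gt (n%:R * xi + c * Num.sqrt n%:R); rewrite intrD.
Qed.

Lemma psi_le0 (R : realType) (x : R) : x <= 0 -> psi x = 0.
Proof. by rewrite /psi => ->. Qed.

Lemma psi_ge1 (R : realType) (x : R) : 1 <= x -> psi x = 1.
Proof. by rewrite /psi => x1; rewrite x1 leNgt (lt_le_trans ltr01 x1). Qed.

(** Used with [u] the size of [f] at [y]: replacing the distance from [y] to [xi] by a [d] at most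
    [c] times larger costs a factor [c] to the power [alpha]. *)
Lemma wbar_mul_powR_le (R : realType) (xi alpha M c d u y : R) :
  0 <= alpha -> 0 <= c -> 0 <= d -> d <= c * `|y - xi| ->
  wbar xi alpha y * u <= M -> 0 <= u -> u * d `^ alpha <= c `^ alpha * M.
Proof.
move=> a0 c0 d0 dc uM u0.
apply: (@le_trans _ _ (u * (c * `|y - xi|) `^ alpha)).
  by rewrite ler_wpM2l// ge0_ler_powR// nnegrE// mulr_ge0.
rewrite powRM// mulrCA ler_wpM2l ?powR_ge0//.
by rewrite mulrC.
Qed.

Lemma Fbar_bound (R : realType) (xi alpha M : R) (n : nat) (f : R -> R) (y : R) :
  0 <= alpha -> xi < 1 -> 0 < xi -> (0 < n)%N -> Bbar_defined n xi ->
  (forall z, 0 <= z <= 1 -> wbar xi alpha z * `|f z| <= M) ->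
  0 <= y <= 1 ->
  `|Fbar n xi f y| * ((Num.sqrt n%:R)^-1 + `|y - xi|) `^ alpha
    <= 4 * 4 `^ alpha * M.
Proof.
move=> a0 xi1 xi0 n0 [h1 h4] fM y01.
have N0 : 0 < n%:R :> R by rewrite ltr0n.
have s0 : 0 < Num.sqrt n%:R :> R by rewrite sqrtr_gt0.
have r0 : 0 < (Num.sqrt n%:R)^-1 :> R by rewrite invr_gt0.
have nr : n%:R^-1 = (Num.sqrt n%:R)^-1 ^+ 2 :> R.
  by rewrite exprVn sqr_sqrtr ?ltW.
have /andP[x1l x1u] := node_itv _ _ xi (- 2) n0.
have /andP[x2l x2u] := node_itv _ _ xi (- 1) n0.
have /andP[x3l x3u] := node_itv _ _ xi 1 n0.
have /andP[x4l x4u] := node_itv _ _ xi 2 n0.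
rewrite -/(x1 n xi) in x1l x1u; rewrite -/(x2 n xi) in x2l x2u.
rewrite -/(x3 n xi) in x3l x3u; rewrite -/(x4 n xi) in x4l x4u.
move: x1l x1u x2l x2u x3l x3u x4l x4u; rewrite nr.
rewrite /Fbar /psi1 /psi2 /interp.
move: (x1 n xi) (x2 n xi) (x3 n xi) (x4 n xi) h1 h4 => a b c d.
set r := (Num.sqrt n%:R)^-1 in r0 *.
move=> h1 h4 al au bl bu cl cu dl du.
(* From 0 <= [a] <= [xi] - 2 [r] and [xi] < 1. Rounding thus moves a node by less than [r] / 2,
   which keeps the four nodes in order. *)
have r2 : r <= 2^-1 by lra.
have rr : r ^+ 2 <= r / 2 by rewrite expr2 ler_wpM2l// ltW.
have D0 : 0 <= r + `|y - xi| by rewrite addr_ge0// ltW.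
have K0 : 0 <= (r + `|y - xi|) `^ alpha by exact: powR_ge0.
have M0 : 0 <= M.
  by apply: le_trans (fM _ y01); rewrite mulr_ge0// powR_ge0.
have KM0 : 0 <= 4 `^ alpha * M by rewrite mulr_ge0// powR_ge0.
have /andP[p1l p1u] := psi_itv _ ((y - a) / (b - a)).
have /andP[p2l p2u] := psi_itv _ ((y - c) / (d - c)).
(* The cutoff factor lies in [0, 2] and vanishes on [[b], [c]]; off this interval [y] is at least
   [r] / 2 away from [xi]. *)
have term1 : `|f y * (1 - psi ((y - a) / (b - a)) + psi ((y - c) / (d - c)))|
    * (r + `|y - xi|) `^ alpha <= 2 * (4 `^ alpha * M).
  have [yin|yout] := boolP (b <= y <= c).
    case/andP: yin => y1 y2.
    rewrite (psi_ge1 _ ((y - a) / _)); last by rewrite ler_pdivlMr; lra.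
    rewrite (psi_le0 _ ((y - c) / _)).
      by rewrite subrr addr0 mulr0 normr0 mul0r mulr_ge0.
    by rewrite pmulr_lle0 ?invr_gt0; lra.
  have yxi : r / 2 <= `|y - xi|.
    rewrite ler_normr; apply/orP.
    move: yout; rewrite negb_and -!ltNge => /orP[yb|cy]; [right|left]; lra.
  have h : `|f y| * (r + `|y - xi|) `^ alpha <= 4 `^ alpha * M.
    by apply: (wbar_mul_powR_le _ xi alpha M 4 _ _ y) => //; [lra|exact: fM].
  rewrite normrM mulrAC mulrC; apply: ler_pM => //.
    by rewrite mulr_ge0.
  by rewrite ger0_norm; lra.
(* The cutoff product vanishes outside ([a], [d]). Inside, the interpolation coefficients are at
   most 1 and [y] is within 3 [r] of [xi], while [a] and [d] are at least [r] away. *)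
have term2 : `|psi ((y - a) / (b - a)) * (1 - psi ((y - c) / (d - c))) *
     ((y - d) / (a - d) * f a + (a - y) / (a - d) * f d)|
    * (r + `|y - xi|) `^ alpha <= 2 * (4 `^ alpha * M).
  have [ya|ay] := leP y a.
    rewrite psi_le0; first by rewrite !mul0r normr0 mul0r mulr_ge0.
    by rewrite pmulr_lle0 ?invr_gt0; lra.
  have [dy|yd] := leP d y.
    rewrite (psi_ge1 _ ((y - c) / _)).
      by rewrite subrr mulr0 mul0r normr0 mul0r mulr_ge0.
    by rewrite ler_pdivlMr; lra.
  have D4 : r + `|y - xi| <= 4 * r.
    by have : `|y - xi| <= 3 * r; [rewrite ler_norml; apply/andP; split|]; lra.
  have fz z : 0 <= z <= 1 -> r <= `|z - xi| ->
      `|f z| * (r + `|y - xi|) `^ alpha <= 4 `^ alpha * M.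
    move=> z01 rz.
    by apply: (wbar_mul_powR_le _ xi alpha M 4 _ _ z) => //; [lra|exact: fM].
  have fa : `|f a| * (r + `|y - xi|) `^ alpha <= 4 `^ alpha * M.
    by apply: fz; [|rewrite ler_normr; apply/orP; right]; lra.
  have fd : `|f d| * (r + `|y - xi|) `^ alpha <= 4 `^ alpha * M.
    by apply: fz; [|rewrite ler_normr; apply/orP; left]; lra.
  apply: (@le_trans _ _ ((`|f a| + `|f d|) * (r + `|y - xi|) `^ alpha)); last lra.
  rewrite ler_wpM2r// normrM -[leRHS]mul1r ler_pM//.
    rewrite ger0_norm; first by rewrite mulr_ile1; lra.
    by rewrite mulr_ge0; lra.
  apply: (le_trans (ler_normD _ _)); rewrite !normrM.
  have q1 : `|(y - d) / (a - d)| <= 1.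
    rewrite -mulrNN -invrN ger0_norm.
      by rewrite ler_pdivrMr; lra.
    by rewrite mulr_ge0 ?invr_ge0; lra.
  have q2 : `|(a - y) / (a - d)| <= 1.
    rewrite -mulrNN -invrN ger0_norm.
      by rewrite ler_pdivrMr; lra.
    by rewrite mulr_ge0 ?invr_ge0; lra.
  rewrite normrM in q1; rewrite normrM in q2.
  by rewrite lerD// ler_piMl.
apply: (@le_trans _ _ (2 * (4 `^ alpha * M) + 2 * (4 `^ alpha * M))); last lra.
apply: le_trans (lerD term1 term2).
by rewrite -mulrDl ler_wpM2r// ler_normD.
Qed.

(** * The weight against exponentials, and the second derivative *)

(** With u = [t / alpha], e^u >= 1 + u gives 2 + [alpha] u <= (2 + [alpha]) e^u; then take the power
    [alpha]. *)
Lemma powR_le_expR (R : realType) (alpha t : R) : 0 < alpha -> 0 <= t ->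
  (2 + t) `^ alpha <= (2 + alpha) `^ alpha * expR t.
Proof.
move=> a0 t0.
have u0 : 0 <= t / alpha by rewrite divr_ge0// ltW.
have -> : expR t = expR (t / alpha) `^ alpha by rewrite -expRM divfK// gt_eqF.
rewrite -powRM ?expR_ge0//; last lra.
have e := expR_ge1Dx (t / alpha).
have ta : t = alpha * (t / alpha) by rewrite mulrC divfK// gt_eqF.
rewrite ge0_ler_powR ?nnegrE ?mulr_ge0 ?expR_ge0//; try lra.
by rewrite mulrDl {1}ta lerD// ?ler_pM2l//; nra.
Qed.

Lemma wbar_le_expR (R : realType) (xi alpha x y r t : R) :
  0 < alpha -> 0 < r -> 0 <= t -> `|x - y| <= r * (1 + t) ->
  wbar xi alpha x <=
    (2 + alpha) `^ alpha * expR t * (r + `|y - xi|) `^ alpha.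
Proof.
move=> a0 r0 t0 xy.
have D0 := normr_ge0 (y - xi).
apply: (@le_trans _ _ ((2 + t) `^ alpha * (r + `|y - xi|) `^ alpha)).
  rewrite -powRM; [|lra..].
  rewrite ge0_ler_powR ?nnegrE ?mulr_ge0//; try lra.
  have -> : x - xi = (x - y) + (y - xi) by ring.
  have := ler_normD (x - y) (y - xi).
  nra.
by rewrite ler_wpM2r ?powR_ge0// powR_le_expR.
Qed.

Lemma wbar_bernstein_deriv2_le (R : realType) (xi alpha K : R) (n : nat)
    (g : R -> R) (x : R) :
  0 < alpha -> 0 <= K -> (4 <= n.+2)%N -> 0 <= x <= 1 ->
  (forall y, 0 <= y <= 1 ->
     `|g y| * ((Num.sqrt n.+2%:R)^-1 + `|y - xi|) `^ alpha <= K) ->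
  `|wbar xi alpha x * derive1n 2 (bernstein n.+2 g) x| <=
    8 * (2 + alpha) `^ alpha * expR 2 * K * n.+2%:R ^+ 2.
Proof.
move=> a0 K0 n4 x01 gK.
have /andP[x0 x1] := x01.
have N4 : 4 <= n.+2%:R :> R by rewrite (ler_nat _ 4).
have N0 : 0 < n.+2%:R :> R by rewrite ltr0n.
move: gK; set r := (Num.sqrt n.+2%:R)^-1 => gK.
have r0 : 0 < r by rewrite invr_gt0 sqrtr_gt0.
have rN : r ^+ 2 = n.+2%:R^-1 by rewrite exprVn sqr_sqrtr// ltW.
have nr : n.+2%:R * r ^+ 2 = 1 by rewrite rN divff// gt_eqF.
have r2 : r <= 2^-1 by nra.
pose A := (2 + alpha) `^ alpha.
have A0 : 0 <= A by exact: powR_ge0.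
pose t k := r * `|k%:R - n%:R * x|.
have t0 k : 0 <= t k by rewrite mulr_ge0// ltW.
have value_bound (k j : nat) : (k <= n)%N -> (k <= j <= k.+2)%N ->
    wbar xi alpha x * `|g (j%:R / n.+2%:R)| <= A * K * expR (t k).
  move=> kn /andP[kj jk].
  have Kj : k%:R <= j%:R :> R by rewrite ler_nat.
  have Jk : j%:R <= k%:R + 2 :> R by rewrite -natrD ler_nat addn2.
  have y01 : 0 <= (j%:R / n.+2%:R : R) <= 1.
    rewrite divr_ge0//= ler_pdivrMr// mul1r ler_nat.
    by rewrite (leq_trans jk).
  have xy : `|x - j%:R / n.+2%:R| <= r * (1 + t k).
    have -> : x - j%:R / n.+2%:R = r ^+ 2 * (n.+2%:R * x - j%:R).
      by rewrite rN mulrBr mulKf ?gt_eqF// mulrC.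
    rewrite normrM ger0_norm ?sqr_ge0// expr2 -mulrA ler_pM2l//.
    (* The centring is at [n] x although the nodes have denominator [n.+2]; the shift is at most 2,
       and 2 [r] <= 1 turns it into the 1 of 1 + [t k]. *)
    have -> : n.+2%:R * x - j%:R
        = - (k%:R - n%:R * x) + (2 * x - (j%:R - k%:R)).
      by rewrite -addn2 natrD; ring.
    have d2 : `|2 * x - (j%:R - k%:R)| <= 2.
      by rewrite ler_norml; apply/andP; split; lra.
    have := ler_normD (- (k%:R - n%:R * x)) (2 * x - (j%:R - k%:R)).
    rewrite normrN /t; nra.
  have := wbar_le_expR _ xi _ _ _ _ _ a0 r0 (t0 k) xy; rewrite -/A => wle.
  apply: (@le_trans _ _ (A * expR (t k) *
      (`|g (j%:R / n.+2%:R)| * (r + `|j%:R / n.+2%:R - xi|) `^ alpha))).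
    by rewrite [leLHS]mulrC [leRHS]mulrCA ler_wpM2l.
  rewrite [leRHS]mulrAC; apply: ler_wpM2l; last exact: gK.
  by rewrite mulr_ge0 ?expR_ge0.
(* From e^|s| <= e^s + e^(-s), with the moment bound at [r] and [- r]; the exponent is at most 2
   since [n] r^2 <= [n.+2] r^2 = 1. *)
have moment : \sum_(k < n.+1) expR (t k) * bernstein_basis n k x <= 2 * expR 2.
  have half (l : R) : `|l| = r ->
      \sum_(k < n.+1) expR (l * (k%:R - n%:R * x)) * bernstein_basis n k x
        <= expR 2.
    move=> lr; apply: (le_trans (bernstein_expR_le _ n x l x01 _)).
      by rewrite lr.
    have l2 : l ^+ 2 = r ^+ 2 by rewrite -real_normK ?num_real// lr.
    have nN : n%:R <= n.+2%:R :> R by rewrite ler_nat -addn2 leq_addr.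
    rewrite ler_expR l2 -[leRHS]mulr1 ler_wpM2l//.
    by apply: le_trans (ler_wpM2r (sqr_ge0 r) nN) _; rewrite nr.
  have rp : `|r| = r by rewrite gtr0_norm.
  have rm : `|- r| = r by rewrite normrN.
  apply: (@le_trans _ _ (expR 2 + expR 2)); last by rewrite -mulr2n mulr_natl.
  apply: le_trans (lerD (half r rp) (half (- r) rm)).
  rewrite -big_split /=; apply: ler_sum => k _.
  rewrite -mulrDl ler_wpM2r ?bernstein_basis_ge0//.
  have -> : t k = `|r * (k%:R - n%:R * x)| by rewrite normrM gtr0_norm.
  have [u0|u0] := leP 0 (r * (k%:R - n%:R * x)).
    by rewrite (ger0_norm u0) lerDl expR_ge0.
  by rewrite (ltr0_norm u0) mulNr lerDr expR_ge0.
(* The 4 is 1 + 2 + 1, the total size of the second-difference coefficients. *)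
have sum_bound : wbar xi alpha x *
    `|\sum_(k < n.+1) (g (k.+2%:R / n.+2%:R) - 2 * g (k.+1%:R / n.+2%:R)
        + g (k%:R / n.+2%:R)) * bernstein_basis n k x|
    <= 4 * (A * K) * (2 * expR 2).
  apply: (@le_trans _ _ (4 * (A * K) *
      \sum_(k < n.+1) expR (t k) * bernstein_basis n k x)); last first.
    by rewrite ler_wpM2l// !mulr_ge0.
  apply: (@le_trans _ _ (wbar xi alpha x *
    \sum_(k < n.+1) `|(g (k.+2%:R / n.+2%:R) - 2 * g (k.+1%:R / n.+2%:R)
        + g (k%:R / n.+2%:R)) * bernstein_basis n k x|)).
    by rewrite ler_wpM2l ?powR_ge0// ler_norm_sum.
  rewrite !mulr_sumr; apply: ler_sum => k _.
  have kn : (k <= n)%N by rewrite -ltnS.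
  have b0 := bernstein_basis_ge0 _ n k x x01.
  rewrite normrM (ger0_norm b0) [leLHS]mulrA [leRHS]mulrA ler_wpM2r//.
  have w0 : 0 <= wbar xi alpha x by exact: powR_ge0.
  set u0 := g (k%:R / _); set u1 := g (k.+1%:R / _); set u2 := g (k.+2%:R / _).
  have v0 : wbar xi alpha x * `|u0| <= A * K * expR (t k).
    by apply: value_bound; rewrite // leqnn !leqW.
  have v1 : wbar xi alpha x * `|u1| <= A * K * expR (t k).
    by apply: value_bound; rewrite // !leqnSn.
  have v2 : wbar xi alpha x * `|u2| <= A * K * expR (t k).
    by apply: value_bound; rewrite // leqnn !leqW.
  have tri : `|u2 - 2 * u1 + u0| <= `|u2| + 2 * `|u1| + `|u0|.
    apply: (le_trans (ler_normD _ _)); rewrite lerD2r.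
    by apply: (le_trans (ler_normB _ _)); rewrite normrM ger0_norm.
  apply: le_trans (ler_wpM2l w0 tri) _; lra.
have nn0 : 0 <= n.+2%:R * n.+1%:R :> R by rewrite mulr_ge0.
rewrite derive1n2_bernstein normrM (ger0_norm (powR_ge0 _ _)) normrM.
rewrite (ger0_norm nn0) [leLHS]mulrCA [leLHS]mulrC.
apply: (@le_trans _ _ (4 * (A * K) * (2 * expR 2) * (n.+2%:R * n.+2%:R))).
  by apply: ler_pM => //; rewrite ler_wpM2l// ler_nat.
by rewrite le_eqVlt /A; apply/orP; left; apply/eqP; ring.
Qed.

Theorem theorem1 (R : realType) (xi alpha : R) (hxi0 : 0 < xi) (hxi1 : xi < 1)
    (halpha : 0 < alpha) :
  exists2 C : R, 0 < C &
    forall (f : R -> R) (n : nat),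
      C_wbar xi alpha f -> (0 < n)%N -> Bbar_defined n xi ->
      (supnorm (fun x => (wbar xi alpha x * derive1n 2 (Bbar n xi f) x)%R)
       <= (C * n%:R ^+ 2)%:E * supnorm (fun x => (wbar xi alpha x * f x)%R))%E.
Proof.
(* The last factor comes from [Fbar_bound], the others from [wbar_bernstein_deriv2_le]. *)
exists (8 * (2 + alpha) `^ alpha * expR 2 * (4 * 4 `^ alpha)).
  by rewrite !mulr_gt0 ?expR_gt0 ?powR_gt0// addr_gt0.
move=> f n _ n0 def.
have N0 : 0 < n%:R :> R by rewrite ltr0n.
set C := 8 * _ * _ * _.
have C0 : 0 < C by rewrite !mulr_gt0 ?expR_gt0 ?powR_gt0// addr_gt0.
have f_le x : 0 <= x <= 1 ->
    (`|wbar xi alpha x * f x|%:E <= supnorm (fun x => (wbar xi alpha x * f x)%R))%E.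
  by move=> x01; apply: ereal_sup_ubound; exists x => //=; rewrite in_itv.
(* The value -oo is excluded by the point 0 of the interval; for +oo the right side is +oo because
   [C] n^2 > 0. *)
case E : (supnorm (fun x => wbar xi alpha x * f x)) => [M| |]; last first.
- by have := f_le 0; rewrite lexx ler01 E => /(_ isT).
- by rewrite gt0_muley ?leey// lte_fin mulr_gt0// exprn_gt0.
have fM x : 0 <= x <= 1 -> wbar xi alpha x * `|f x| <= M.
  move=> /f_le; rewrite E lee_fin normrM.
  by rewrite (ger0_norm (powR_ge0 _ _)).
have M0 : 0 <= M.
  by apply: le_trans (fM 0 _); rewrite ?lexx ?ler01// mulr_ge0// powR_ge0.
(* The condition 0 <= [x1] forces 2 / sqrt n <= [xi] < 1. *)
have n4 : (4 <= n)%N.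
  have [h1 _] := def; have /andP[_] := node_itv _ _ xi (- 2) n0.
  rewrite -/(x1 n xi) => x1u.
  have s0 : 0 < Num.sqrt n%:R :> R by rewrite sqrtr_gt0.
  have : 2 / Num.sqrt n%:R <= 1 :> R by lra.
  rewrite ler_pdivrMr// mul1r => s2.
  have ss : Num.sqrt n%:R ^+ 2 = n%:R :> R by rewrite sqr_sqrtr// ltW.
  rewrite -(ler_nat R) -ss; move: s2; set s := Num.sqrt _ => s2.
  nra.
apply: ge_ereal_sup => _ /= [x /[!in_itv]/= x01 <-].
rewrite -EFinM lee_fin.
have K0 : 0 <= 4 * 4 `^ alpha * M by rewrite !mulr_ge0// powR_ge0.
case: n n0 def n4 N0 {E f_le} => [//|[//|n]] n0 def n4 N0.
have := wbar_bernstein_deriv2_le _ xi alpha _ n (Fbar n.+2 xi f) x halpha K0 n4 x01.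
move=> /(_ (fun y => Fbar_bound _ xi alpha M n.+2 f y (ltW halpha) hxi1 hxi0 n0 def fM)).
by move=> /le_trans; apply; rewrite le_eqVlt /C; apply/orP; left; apply/eqP; ring.
Qed.
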